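(* Let $G=(V,E)$ be a finite signed graph with at least one edge, let $\Delta^\tau$ be its twisted Laplacian, and let $d_{max}=\max_{x\in V} d(x)$ be the maximal valency. Let $\mu_1$ be the smallest eigenvalue of $\Delta^\tau$ (possibly $0$). Then \[ \frac{\psi(G)^2}{2 d_{max}} \;\leq\; d_{max} - \sqrt{ d_{max}^2 - \psi(G)^2 } \;\leq\; \mu_1 \;\leq\; \tilde{\psi}(G) \;\leq\; 2 \psi(G). \]
   Context: A signed graph is a finite simple undirected graph $G=(V,E)$ with nonempty vertex set together with a sign $\mathrm{sgn}\, e\in\{-1,1\}$ for each edge $e$; write $\mathrm{sgn}(x,y)=\mathrm{sgn}(y,x)$ for the sign of the edge between $x$ and $y$. $N(x)$ is the set of neighbours of $x$ and $d(x)=|N(x)|$ its valency. The twisted Laplacian is the operator $\Delta^\tau:\mathbb{R}^V\to\mathbb{R}^V$, \[ \Delta^\tau f(x) = |N(x)| f(x) - \sum_{y\in N(x)} \mathrm{sgn}(x,y) f(y), \] which is symmetric for the standard inner product on $\mathbb{R}^V$. The sign of a cycle $C$ is $\mathrm{sgn}\, C=\prod_{e\in C}\mathrm{sgn}\, e$. A signed graph is coherently signed if every cycle has sign $+1$. For $S\subset V$, $\partial S$ is the set of edges between $S$ and $S^{\mathsf c}=V\setminus S$, and $e_{mc}(S)$ is the minimal number of edges that need to be removed from the subgraph induced on $S$ so that the resulting graph is coherently signed. Define, for $\varnothing\neq S\subset V$, \[ \psi(S)=\frac{|\partial S|+2e_{mc}(S)}{|S|},\qquad \psi(G)=\min_{\varnothing\neq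 S\subset V}\psi(S),\qquad \tilde\psi(G)=\min_{\varnothing\neq S\subset V}\frac{|\partial S|+4e_{mc}(S)}{|S|}. \] The minima are over all nonempty subsets of $V$, including $V$ itself. *)

(* Defs.v *)
From HB Require Import structures.
From mathcomp Require Import all_boot all_order all_algebra.
From mathcomp Require Import boolp reals complex.

Set Implicit Arguments.
Unset Strict Implicit.
Unset Printing Implicit Defensive.

Import Order.TTheory GRing.Theory Num.Theory.
Local Open Scope ring_scope.

(* An edge is the two-element set of its endpoints; [sgn] is only meaningful on
   members of [edges]. *)
Record signed_graph (V : finType) := SignedGraph {
  edges : {set {set V}};
  sgn : {set V} -> int;
  vertex_nonempty : (0 < #|V|)%N;
  edges_card2 : {in edges, forall e : {set V}, #|e| = 2%N};
  sgn_edge : {in edges, forall e, sgn e = 1 \/ sgn e = -1}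
}.

Section Combinatorics.
Variables (V : finType) (G : signed_graph V).
Implicit Types (S : {set V}) (F : {set {set V}}) (x y : V).

(* Since edges have two elements, [adj F x x] is false whenever F consists of
   edges of G. *)
Definition adj F : rel V := fun x y => [set x; y] \in F.

Definition nbr x : {set V} := [set y | adj (edges G) x y].

Definition deg x : nat := #|nbr x|.

Definition max_deg : nat := (\max_(x : V) deg x)%N.

(* A cycle visits at least three vertices, without repetition, and closes up. *)
Definition is_cycle F (c : seq V) : bool :=
  [&& (2 < size c)%N, uniq c & cycle (adj F) c].

Definition cycle_sgn (c : seq V) : int :=
  \prod_(x <- c) sgn G [set x; next c x].

(* Coherence of the signed subgraph of G with edge set F. *)
Definition coherently_signed F : Prop :=
  forall c : seq V, is_cycle F c -> cycle_sgn c = 1.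

Definition boundary S : {set {set V}} :=
  [set e in edges G | [exists x in S, [exists y in ~: S, e == [set x; y]]]].

Definition induced_edges S : {set {set V}} := [set e in edges G | e \subset S].

Definition coherent_after_removal S F : bool :=
  (F \subset induced_edges S) &&
  `[< coherently_signed (induced_edges S :\: F) >].

Definition emc S : nat :=
  #|[arg min_(F < induced_edges S | coherent_after_removal S F) #|F|]|.

Lemma coherent_after_removal_all S : coherent_after_removal S (induced_edges S).
Proof.
rewrite /coherent_after_removal subxx /=; apply/asboolP => -[|x [|y c]] //.
by rewrite /is_cycle /= {1}/adj setDv in_set0 !andbF.
Qed.

Lemma emcP S :
  (exists2 F, coherent_after_removal S F & #|F| = emc S) /\
  (forall F, coherent_after_removal S F -> (emc S <= #|F|)%N).
Proof.
rewrite /emc; case: arg_minnP => [|F cF minF].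
  exact: coherent_after_removal_all.
by split; [exists F | exact: minF].
Qed.

End Combinatorics.

Section Spectral.
Variables (R : realType) (V : finType) (G : signed_graph V).
Implicit Types S : {set V}.

Definition psi_set S : R := (#|boundary G S| + 2 * emc G S)%:R / #|S|%:R.

Definition tpsi_set S : R := (#|boundary G S| + 4 * emc G S)%:R / #|S|%:R.

(* [setT] is a valid default because the vertex set is nonempty. *)
Definition psi : R :=
  psi_set [arg min_(S < [set: V] | S != set0) psi_set S]%O.

Definition tpsi : R :=
  tpsi_set [arg min_(S < [set: V] | S != set0) tpsi_set S]%O.

Let setT_neq0 : [set: V] != set0.
Proof. by rewrite -card_gt0 cardsT (vertex_nonempty G). Qed.

Lemma psiP :
  (exists2 S, S != set0 & psi_set S = psi) /\
  (forall S, S != set0 -> psi <= psi_set S).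
Proof.
rewrite /psi; case: arg_minP => [|S S0 minS]; first exact: setT_neq0.
by split; [exists S | exact: minS].
Qed.

Lemma tpsiP :
  (exists2 S, S != set0 & tpsi_set S = tpsi) /\
  (forall S, S != set0 -> tpsi <= tpsi_set S).
Proof.
rewrite /tpsi; case: arg_minP => [|S S0 minS]; first exact: setT_neq0.
by split; [exists S | exact: minS].
Qed.

Definition twisted_laplacian_fun (f : {ffun V -> R^o}) : {ffun V -> R^o} :=
  [ffun x => #|nbr G x|%:R * f x
             - \sum_(y in nbr G x) (sgn G [set x; y])%:~R * f y].

Fact twisted_laplacian_is_linear : linear twisted_laplacian_fun.
Proof.
move=> a f g; apply/ffunP => x; rewrite !ffunE.
under eq_bigr do rewrite !ffunE mulrDr mulrCA.
rewrite big_split /= -mulr_sumr mulrDr mulrCA opprD addrACA.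
by rewrite /GRing.scale /= mulrBr.
Qed.

HB.instance Definition _ := GRing.isLinear.Build R {ffun V -> R^o}
  {ffun V -> R^o} _ twisted_laplacian_fun twisted_laplacian_is_linear.

Definition twisted_laplacian : 'End({ffun V -> R^o}) :=
  linfun twisted_laplacian_fun.

Definition smallest_eigenvalue (mu : R) : Prop :=
  passmx.leigenvalue twisted_laplacian mu /\
  forall la : R, passmx.leigenvalue twisted_laplacian la -> mu <= la.

Lemma leigenvalue_twistedP (mu : R) :
  reflect (exists2 f : {ffun V -> R^o},
             twisted_laplacian_fun f = mu *: f & f != 0)
          (passmx.leigenvalue twisted_laplacian mu).
Proof.
have ker f : (f \in passmx.leigenspace twisted_laplacian mu)
             = (twisted_laplacian_fun f == mu *: f).
  by rewrite memv_ker add_lfunE opp_lfunE scale_lfunE id_lfunE lfunE subr_eq0.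
apply: (iffP idP) => [nz | [f fE f0]].
  exists (vpick (passmx.leigenspace twisted_laplacian mu)); last first.
    by rewrite vpick0.
  by apply/eqP; rewrite -ker memv_pick.
apply: contraNneq f0 => E.
by have := ker f; rewrite E memv0 fE eqxx => ->.
Qed.

End Spectral.

Lemma least_root_exists (R : realFieldType) (p : {poly R}) a :
  p != 0 -> root p a ->
  exists2 m, root p m & forall b, root p b -> m <= b.
Proof.
elim: {p}(size p) {-2}p (leqnn (size p)) a => [|n IH] p sp a p0 pa.
  by rewrite leqn0 size_poly_eq0 (negPf p0) in sp.
have /factor_theorem [q pE] := pa.
have q0 : q != 0 by apply: contraNneq p0 => q0; rewrite pE q0 mul0r.
have sq : (size q <= n)%N.
  by move: sp; rewrite pE size_Mmonic ?monicXsubC// size_XsubC addn2.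
have rE b : root p b = root q b || (b == a) by rewrite pE rootM root_XsubC.
case: (pselect (exists b, root q b)) => [[b qb]|nq].
  have [m qm mm] := IH q sq b q0 qb.
  case: (leP m a) => h.
    exists m => [|c]; rewrite rE ?qm// => /orP[/mm//|/eqP->//].
  exists a => [|c]; rewrite rE ?eqxx ?orbT// => /orP[/mm|/eqP->//].
  exact/le_trans/ltW.
exists a => // c; rewrite rE => /orP[qc|/eqP->//].
by case: nq; exists c.
Qed.

Section SymmetricEigenvalue.
Local Open Scope complex_scope.

Lemma symmetric_eigenvalue_exists (R : rcfType) n (M : 'M[R]_n) :
  (0 < n)%N -> M^T = M ->
  exists a, eigenvalue M a.
Proof.
move=> n0 Ms; pose f := real_complex R.
have [l /eigenvalueP[v vE v0]] := eigenvalue_closed (map_mx f M) n0.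
pose vc := map_mx (@conjc R) v.
have vcE : vc *m map_mx f M = l^* *: vc.
  have -> : map_mx f M = map_mx (@conjc R) (map_mx f M).
    by apply/matrixP => i j; rewrite !mxE /f /= oppr0.
  rewrite -map_mxM vE; apply/matrixP => i j; rewrite !mxE rmorphM.
  by [].
have E : l *: (v *m vc^T) = l^* *: (v *m vc^T).
  rewrite scalemxAl -vE -mulmxA.
  have -> : map_mx f M *m vc^T = (vc *m map_mx f M)^T.
    by rewrite trmx_mul; congr (_ *m _); apply/matrixP => i j;
      rewrite !mxE -{1}Ms mxE.
  by rewrite vcE linearZ -scalemxAr.
have nz : (v *m vc^T) 0 0 != 0.
  rewrite mxE; apply: contraNneq v0 => /eqP.
  have pos i : true -> 0 <= v 0 i * vc^T i 0.
    by move=> _; rewrite !mxE mul_conjC_ge0.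
  rewrite psumr_eq0 => [/allP h|i _]; last exact: pos.
  apply/eqP/rowP => i; have := h i (mem_index_enum i).
  rewrite !mxE mul_conjC_eq0.
  by move/eqP.
have lr : l = l^*.
  by move/matrixP/(_ 0 0): E; rewrite mxE [RHS]mxE => /(mulIf nz).
exists (complex.Re l).
rewrite -(eigenvalue_map f); apply/eigenvalueP; exists v => //.
rewrite vE; congr (_ *: _); move: lr; case: l {vE vcE E} => x y /= [].
rewrite /f /real_complex_def => /eqP.
rewrite -addr_eq0 -mulr2n mulrn_eq0 /= => /eqP->.
by [].
Qed.

End SymmetricEigenvalue.

Lemma smallest_eigenvalue_exists (R : realType) (V : finType)
    (G : signed_graph V) : exists mu : R, smallest_eigenvalue G mu.
Proof.
pose M : 'M[R]_#|V| := \matrix_(i, j)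
  ((i == j)%:R * #|nbr G (enum_val i)|%:R
   - (enum_val j \in nbr G (enum_val i))%:R
     * (sgn G [set enum_val i; enum_val j])%:~R).
have Ms : M^T = M.
  apply/matrixP => i j; rewrite !mxE !inE /adj setUC; congr (_ - _).
  by rewrite eq_sym; case: eqP => [->|]//; rewrite !mul0r.
have key (v : 'rV_#|V|) (f : {ffun V -> R^o}) :
    (forall x, f x = v 0 (enum_rank x)) -> forall mu,
    v *m M = mu *: v <-> twisted_laplacian_fun G f = mu *: f.
  move=> fv mu.
  have E x : (v *m M) 0 (enum_rank x) = twisted_laplacian_fun G f x.
    rewrite -[v in LHS]trmxK -[M]Ms -trmx_mul !mxE ffunE.
    rewrite -[RHS]/(_ - _).
    under eq_bigr do rewrite !mxE mulrBl.
    rewrite big_split /= sumrN; congr (_ - _).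
      rewrite (bigD1 (enum_rank x)) //= eqxx enum_rankK mul1r fv.
      by rewrite big1 ?addr0// => i /negPf ne; rewrite eq_sym ne !mul0r.
    rewrite [RHS]big_mkcond (reindex_onto enum_rank enum_val) /=; last first.
      by move=> *; exact: enum_valK.
    apply: eq_big => [y|y _]; first by rewrite enum_rankK eqxx.
    rewrite !enum_rankK fv; case: ifP => _; by rewrite ?mul0r ?mul1r.
  split=> h.
    by apply/ffunP => x; rewrite -E h mxE ffunE fv.
  apply/rowP => j; rewrite -[j]enum_valK E h ffunE mxE fv //.
have eigE mu :
    passmx.leigenvalue (twisted_laplacian R G) mu = root (char_poly M) mu.
  rewrite -eigenvalue_root_char.
  apply/leigenvalue_twistedP/eigenvalueP => -[f fE f0].
    exists (\row_i f (enum_val i)).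
      by apply/(key _ f) => // x; rewrite mxE enum_rankK.
    apply: contraNneq f0 => /rowP h; apply/eqP/ffunP => x.
    by have := h (enum_rank x); rewrite !mxE enum_rankK ffunE.
  exists [ffun x => f 0 (enum_rank x)].
    by apply/(key f) => // x; rewrite ffunE.
  apply: contraNneq f0 => /ffunP h; apply/eqP/rowP => j.
  by have := h (enum_val j); rewrite !ffunE enum_valK mxE.
have [a aE] := symmetric_eigenvalue_exists (vertex_nonempty G) Ms.
rewrite eigenvalue_root_char in aE.
have [|m m1 m2] := least_root_exists _ aE.
  exact/monic_neq0/char_poly_monic.
by exists m; split=> [|l]; rewrite eigE // => /m2.
Qed.

(* Main.v *)
Require Import Defs.
From mathcomp Require Import all_boot all_order all_algebra.
From mathcomp Require Import boolp reals complex ring lra.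
Set Implicit Arguments.
Unset Strict Implicit.
Unset Printing Implicit Defensive.
Import Order.TTheory GRing.Theory Num.Theory.
Local Open Scope ring_scope.

(* Upper bound: a coherently signed subgraph can be switched to all signs +1,
   so a signed indicator of S is a test function for the Rayleigh quotient.
   Lower bound: for an eigenvector f, switch by the signs of f and call an edge
   unbalanced if its switched sign is -1. Removing the unbalanced edges inside
   a superlevel set of f^2 makes it coherent, so the coarea formula for f^2
   produces psi, and Cauchy-Schwarz yields psi^2 <= p (2 d_max - p) for some
   p <= mu_1. In that step an unbalanced edge is given the weight
   f(x)^2 + f(y)^2 instead of the larger (|f(x)| + |f(y)|)^2.
   Sums over edges are written as sums over ordered pairs of adjacent vertices,
   hence the factors 2. *)

(** * Rayleigh inequality for real symmetric matrices *)

Section Rayleigh.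
Local Open Scope complex_scope.
Local Open Scope sesquilinear_scope.

(** Over the complex numbers [M] is hermitian, hence unitarily diagonalizable. In the coordinates
    [w] both forms are weighted sums of squared moduli, and the weights [D 0 i] are real eigenvalues
    of [M]. *)
Lemma symmetric_rayleigh (R : rcfType) n (M : 'M[R]_n) (m : R) :
  M^T = M -> (forall a, eigenvalue M a -> m <= a) ->
  forall v : 'rV_n, m * (v *m v^T) 0 0 <= (v *m M *m v^T) 0 0.
Proof.
move=> Ms mle v; pose f := real_complex R; pose A := map_mx f M.
have fC k l (B : 'M[R]_(k, l)) : (map_mx f B)^t* = map_mx f B^T.
  by apply/matrixP => i j; rewrite !mxE conj_Creal //;
    apply/complex_realP; exists (B j i).
have Ah : A \is hermsymmx by rewrite is_hermitianmxE expr0 scale1r fC Ms.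
have /orthomx_spectralP AE := hermitian_normalmx Ah.
set P := spectralmx A in AE; set D := spectral_diag A in AE.
have Pu : P \is unitarymx by exact: spectral_unitarymx.
have PP : P^t* *m P = 1%:M by rewrite -invmx_unitary // mulVmx // unitarymx_unit.
have eigD i : exists2 a, D 0 i = f a & m <= a.
  have rE : row i P *m A = D 0 i *: row i P.
    by rewrite {1}AE !mulmxA -row_mul mulmxV ?unitarymx_unit // row1 -rowE
      row_diag_mx -scalemxAl -rowE.
  have eD : eigenvalue A (D 0 i).
    apply/eigenvalueP; exists (row i P) => //.
    (* A row of the unitary [P] is nonzero: times [P^t*] it is a row of the identity. *)
    apply/eqP => /(congr1 (mulmx^~ (P^t*))) /eqP.
    by rewrite -row_mul (unitarymxP Pu) mul0mx row1 => /eqP/rowP/(_ i)/eqP;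
      rewrite !mxE !eqxx oner_eq0.
  have /mxOverP/(_ 0 i)/complex_realP[a DE] := hermitian_spectral_diag_real Ah.
  by exists a => //; apply: mle;
    rewrite -(eigenvalue_map f) [X in eigenvalue _ X](esym DE).
pose w := map_mx f v *m P^t*.
have wC : w^t* = P *m (map_mx f v)^t*.
  by rewrite trmx_mul map_mxM trmxCK.
have vv : f ((v *m v^T) 0 0) = (w *m w^t*) 0 0.
  rewrite wC mulmxA -[w *m P]mulmxA PP mulmx1 fC -map_mxM.
  by rewrite [RHS]mxE.
have vMv : f ((v *m M *m v^T) 0 0) = (w *m diag_mx D *m w^t*) 0 0.
  rewrite wC /w -(invmx_unitary Pu) !mulmxA -[_ *m invmx P *m _]mulmxA.
  rewrite -[_ *m (_ *m _) *m P]mulmxA -AE fC -!map_mxM.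
  by rewrite [RHS]mxE.
rewrite -lecR rmorphM /= -!/(f _) vv vMv mul_mx_diag !mxE mulr_sumr.
apply: ler_sum => i _; rewrite !mxE [in leRHS]mulrAC [in leRHS]mulrC.
have [a -> ma] := eigD i.
by rewrite ler_wpM2r ?lecR ?mul_conjC_ge0.
Qed.
End Rayleigh.

(** * Quadratic form of the twisted Laplacian *)

Section QuadraticForm.
Variables (R : realType) (V : finType) (G : signed_graph V).
Local Notation E := (edges G).
Local Notation s x y := ((sgn G [set x; y])%:~R : R).

Lemma adjC (F : {set {set V}}) x y : adj F x y = adj F y x.
Proof. by rewrite /adj setUC. Qed.

Lemma sum_arcsC (F : V -> V -> R) :
  \sum_(p | adj E p.1 p.2) F p.2 p.1 = \sum_(p | adj E p.1 p.2) F p.1 p.2.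
Proof.
rewrite [RHS](reindex_inj (h := fun p => (p.2, p.1))) /=; last first.
  by move=> [? ?] [? ?] [-> ->].
by apply: eq_bigl => p; rewrite adjC.
Qed.

Lemma sum_arcs_nbr (F : V -> V -> R) :
  \sum_(p | adj E p.1 p.2) F p.1 p.2 = \sum_x \sum_(y in nbr G x) F x y.
Proof.
rewrite pair_big_dep; apply: eq_bigl => p; by rewrite inE.
Qed.

Lemma sum_arcs_deg (w : V -> R) :
  \sum_(p | adj E p.1 p.2) w p.1 = \sum_x (deg G x)%:R * w x.
Proof.
rewrite (sum_arcs_nbr (fun x _ => w x)); apply: eq_bigr => x _.
by rewrite sumr_const mulr_natl.
Qed.

Lemma sgn_sqr x y : adj E x y -> s x y ^+ 2 = 1.
Proof. by case/sgn_edge => ->; rewrite ?expr1n // rmorphN1 sqrrN expr1n. Qed.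

(** Expand the square with [sgn_sqr]; reversing arcs identifies the two sums of squares, and each is
    the valency-weighted sum of [f x ^+ 2]. *)
Lemma twisted_quadratic_form (f : {ffun V -> R^o}) :
  2 * \sum_x f x * twisted_laplacian_fun G f x
  = \sum_(p | adj E p.1 p.2) (f p.1 - s p.1 p.2 * f p.2) ^+ 2.
Proof.
have -> : \sum_(p | adj E p.1 p.2) (f p.1 - s p.1 p.2 * f p.2) ^+ 2 =
    \sum_(p | adj E p.1 p.2) (f p.1 ^+ 2 + f p.2 ^+ 2
      - 2 * (f p.1 * (s p.1 p.2 * f p.2))).
  apply: eq_bigr => p /sgn_sqr s2; rewrite sqrrB exprMn s2 mul1r.
  by rewrite mulr_natl; ring.
rewrite sumrB big_split /= (sum_arcsC (fun x _ => f x ^+ 2)).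
rewrite (sum_arcs_nbr (fun x _ => f x ^+ 2)) -mulr_sumr.
rewrite (sum_arcs_nbr (fun x y => f x * (s x y * f y))).
rewrite -mulr2n -[X in _ = X - _]mulr_natl -mulrBr -sumrB; congr (_ * _).
apply: eq_bigr => x _; rewrite ffunE -[in LHS]/(_ - _) mulrBr.
rewrite sumr_const -[X in _ = X - _]mulr_natl mulr_sumr; congr (_ - _).
by rewrite mulrCA expr2.
Qed.

Definition laplacian_mx : 'M[R]_#|V| := \matrix_(i, j)
  ((i == j)%:R * (deg G (enum_val i))%:R
   - (enum_val j \in nbr G (enum_val i))%:R * s (enum_val i) (enum_val j)).

Lemma laplacian_mx_sym : laplacian_mx^T = laplacian_mx.
Proof.
apply/matrixP => i j; rewrite !mxE !inE /adj setUC; congr (_ - _).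
by rewrite eq_sym; case: eqP => [->|]//; rewrite !mul0r.
Qed.

Lemma mul_laplacian_mx (f : {ffun V -> R^o}) :
  (\row_i f (enum_val i)) *m laplacian_mx
  = \row_i twisted_laplacian_fun G f (enum_val i).
Proof.
(* By symmetry, the right action on rows agrees with the operator. *)
apply/rowP => i; rewrite -laplacian_mx_sym !mxE ffunE -[RHS]/(_ - _).
under eq_bigr do rewrite !mxE mulrBr.
rewrite sumrB; congr (_ - _).
  rewrite (bigD1 i) //= eqxx mul1r mulrC big1 ?addr0 // => j /negPf ne.
  by rewrite eq_sym ne mul0r mulr0.
rewrite [RHS]big_mkcond [RHS](reindex_onto enum_val enum_rank) /=; last first.
  by move=> *; exact: enum_rankK.
apply: eq_big => [j|j _]; first by rewrite enum_valK eqxx.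
by case: ifP; rewrite ?mul1r ?mul0r ?mulr0 // mulrC.
Qed.

Lemma eigenvalue_laplacian_mx mu :
  eigenvalue laplacian_mx mu -> passmx.leigenvalue (twisted_laplacian R G) mu.
Proof.
case/eigenvalueP => v vE v0; apply/leigenvalue_twistedP.
pose f : {ffun V -> R^o} := [ffun x => v 0 (enum_rank x)].
have fE : v = \row_i f (enum_val i).
  by apply/rowP => i; rewrite mxE ffunE enum_valK.
exists f.
  apply/ffunP => x; move: vE; rewrite fE mul_laplacian_mx.
  by move=> /rowP/(_ (enum_rank x)); rewrite !mxE enum_rankK => ->; rewrite [RHS]ffunE.
apply: contraNneq v0 => f0; rewrite fE f0; apply/eqP/rowP => i.
by rewrite !mxE ffunE.
Qed.

Lemma smallest_eigenvalue_rayleigh mu (f : {ffun V -> R^o}) :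
  smallest_eigenvalue G mu ->
  mu * \sum_x f x ^+ 2 <= \sum_x f x * twisted_laplacian_fun G f x.
Proof.
case=> _ mumin; pose v : 'rV[R]_#|V| := \row_i f (enum_val i).
have dotE (g : {ffun V -> R^o}) :
    ((\row_i g (enum_val i)) *m v^T) 0 0 = \sum_x f x * g x.
  rewrite (reindex_onto enum_val enum_rank) /=; last by move=> *; exact: enum_rankK.
  rewrite mxE; apply: eq_big => [i|i _]; first by rewrite enum_valK eqxx.
  by rewrite !mxE mulrC.
have := symmetric_rayleigh laplacian_mx_sym
  (fun a aE => mumin a (eigenvalue_laplacian_mx aE)) v.
by rewrite mul_laplacian_mx !dotE.
Qed.

End QuadraticForm.

(** * Switching coherently signed graphs to positive signs *)

Section Switching.
Variables (V : finType) (G : signed_graph V).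

Lemma set2_eq (T : finType) (x y a b : T) :
  [set x; y] = [set a; b] -> (x = a /\ y = b) \/ (x = b /\ y = a).
Proof.
move=> /setP xyE; have := (xyE x, xyE y, xyE a, xyE b).
rewrite !inE !eqxx !orbT /= => -[[[xab yab] /esym axy] /esym bxy].
have [xa|xNa] := eqVneq x a.
  have [yb|yNb] := eqVneq y b; first by left.
  have yE : y = a by move: yab; rewrite (negPf yNb) orbF => /esym/eqP.
  by left; split=> //; move: bxy; rewrite xa yE orbb => /esym/eqP.
have xE : x = b by move: xab; rewrite (negPf xNa) => /esym/eqP.
by right; split=> //; move: axy; rewrite eq_sym (negPf xNa) => /esym/eqP.
Qed.

(** Splits off the closing edge, so that the rest is a product along a path. *)
Lemma cycle_sgn_cons a p : uniq (a :: p) ->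
  cycle_sgn G (a :: p) =
  \prod_(i < size p) sgn G [set nth a (a :: p) i; nth a p i]
  * sgn G [set last a p; a].
Proof.
move=> up; rewrite /cycle_sgn (big_nth a) big_mkord.
(* At the last vertex [nth a p i] runs past the end of [p] and returns the default [a], which is the
   cyclic successor. *)
have nextE i : (i < size (a :: p))%N ->
    next (a :: p) (nth a (a :: p) i) = nth a p i.
  by move=> i_lt; rewrite next_nth mem_nth // index_uniq.
rewrite (eq_bigr _ (fun i _ => congr1 (fun z => sgn G [set _; z])
  (nextE _ (ltn_ord i)))) big_ord_recr /=; congr (_ * _).
by rewrite (nth_default _ (leqnn _)) (last_nth a).
Qed.

(** The exponents telescope. The default [c] is separate from [a] because the starting vertex moves
    in the induction. *)
Lemma path_sgn (F : {set {set V}}) (theta : V -> bool) c a p :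
  (forall x y, adj F x y -> sgn G [set x; y] = (-1) ^+ (theta x (+) theta y)) ->
  path (adj F) a p ->
  \prod_(i < size p) sgn G [set nth c (a :: p) i; nth c p i]
  = (-1) ^+ (theta a (+) theta (last a p)).
Proof.
move=> thetaP; elim: p a => [|b p IH] a; first by rewrite big_ord0 addbb.
rewrite big_ord_recl => /andP[acb bp]; rewrite thetaP // (IH b bp).
by rewrite -signr_addb -addbA (addbA (theta b)) addbb.
Qed.

(** Induction on the number of edges: switch [F] without one edge [e], then correct the switching if
    it fails on [e]. *)
Lemma coherently_signed_switching (F : {set {set V}}) :
  F \subset edges G -> coherently_signed G F ->
  exists theta : V -> bool, forall x y,
    adj F x y -> sgn G [set x; y] = (-1) ^+ (theta x (+) theta y).
Proof.
have [n] := ubnP #|F|; elim: n F => // n IH F /ltnSE-leFn sFE cF.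
have [->|[e eF]] := set_0Vmem F.
  by exists xpred0 => x y; rewrite /adj in_set0.
have eE := subsetP sFE _ eF; pose F' := F :\ e.
have sF'F : F' \subset F by exact: subsetDl.
have adjF' x y : adj F x y = adj F' x y || ([set x; y] == e).
  by rewrite /adj in_setD1; case: eqP => [->|]; rewrite ?eF ?orbF.
have [||c /and3P[c2 uc cc]|theta thetaP] := IH F'.
- by apply: leq_trans leFn; rewrite /F' (cardsD1 e F) eF.
- exact: subset_trans sF'F sFE.
- apply: cF; rewrite /is_cycle c2 uc /=.
  by apply: sub_cycle cc => x y; exact: (subsetP sF'F).
have /cards2P[a [b [ab eab]]] : #|e| == 2%N by rewrite (edges_card2 eE).
have ends x y : [set x; y] = e -> (x = a /\ y = b) \/ (x = b /\ y = a).
  by rewrite eab => /set2_eq.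
(* [k] records whether [theta] gives the wrong sign on [e]. *)
have [k kP] : exists k : bool,
    sgn G e = (-1) ^+ (theta a (+) theta b (+) k).
  have [->|->] := sgn_edge eE.
    by exists (theta a (+) theta b); rewrite addbb.
  by exists (~~ (theta a (+) theta b)); rewrite addbN addbb.
have F'_sym : connect_sym (adj F').
  by apply: sym_connect_sym => x y; rewrite adjC.
have [/connectP[p0 ap0 bE]|nab] := boolP (connect (adj F') a b).
  (* The edge e closes a path of F' into a cycle of F, so k must be 0. *)
  case/shortenP: ap0 bE => p ap up _ bE.
  exists theta => x y; rewrite adjF' => /orP[/thetaP //|/eqP xyE].
  have cyc : is_cycle F (a :: p).
    apply/and3P; split=> //.
      (* An empty [p] would give [a = b], and a single step would be [e] itself, which is not in
         [F']. *)
      case: p ap {up} bE => [|y1 [|//]] /=.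
        by move=> _ /esym/eqP; rewrite (negPf ab).
      by rewrite andbT /adj => h bE; move: h; rewrite -bE -eab in_setD1 eqxx.
    rewrite /cycle rcons_path -bE adjF' setUC -eab eqxx orbT andbT.
    by apply: sub_path ap => u v; rewrite adjF' => ->.
  have := cF _ cyc; rewrite (cycle_sgn_cons up) (path_sgn _ thetaP ap) -bE.
  rewrite [X in sgn G X]setUC -eab kP -signr_addb addbA addbb addFb.
  rewrite xyE kP; case: k {kP} => // _.
  rewrite addbF.
  by have [[-> ->]|[-> ->]] := ends _ _ xyE; rewrite // addbC.
(* Otherwise flip [theta] on the component of [b] when [k] holds: edges of [F'] stay inside one
   component, and [e] has only the end [b] in it. *)
exists (fun x => theta x (+) (k && connect (adj F') b x)) => x y.
have nba : connect (adj F') b a = false by rewrite F'_sym (negPf nab).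
rewrite adjF' => /orP[xy|/eqP xyE].
  rewrite (thetaP _ _ xy) (same_connect_r F'_sym (connect1 xy)).
  by rewrite addbACA addbb addbF.
rewrite xyE kP; have [[-> ->]|[-> ->]] := ends _ _ xyE;
  rewrite nba connect0 andbT andbF addbF ?addbA //.
by rewrite -addbA addbC.
Qed.

End Switching.

(** * Edge counts as sums over arcs *)

Section EdgeCounting.
Variables (V : finType) (G : signed_graph V).
Local Notation E := (edges G).

Lemma adj_neq x y : adj E x y -> x != y.
Proof. by move=> /edges_card2; rewrite cards2; case: eqVneq. Qed.

(** Group the arcs by their underlying edge: each fibre consists of the two orientations. *)
Lemma card_arcs (F : {set {set V}}) : F \subset E ->
  #|[pred p : V * V | adj F p.1 p.2]| = (2 * #|F|)%N.
Proof.
move=> sFE; rewrite -[LHS]sum1_card.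
rewrite (partition_big (fun p : V * V => [set p.1; p.2]) (mem F)) //=.
rewrite mulnC -sum_nat_const; apply: eq_bigr => e eF.
have /cards2P[a [b [ab eab]]] : #|e| == 2%N.
  by rewrite (edges_card2 (subsetP sFE _ eF)).
have abba : (a, b) != (b, a) by rewrite xpair_eqE (negPf ab).
transitivity #|[set (a, b); (b, a)]|; last by rewrite cards2 abba.
rewrite -sum1_card.
apply: eq_bigl => -[x y]; rewrite !inE /= !xpair_eqE.
apply/andP/idP => [[_ /eqP]|].
  by rewrite eab => /set2_eq[] [-> ->]; rewrite !eqxx ?orbT.
rewrite /adj; case/orP=> /andP[/eqP-> /eqP->]; last rewrite setUC.
  by rewrite -eab.
by rewrite -eab.
Qed.

Lemma sum_arcs_adj (R : realType) (F : {set {set V}}) : F \subset E ->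
  \sum_(p | adj E p.1 p.2) (adj F p.1 p.2)%:R = (2 * #|F|)%:R :> R.
Proof.
move=> sFE; rewrite -(card_arcs sFE) -sum1_card natr_sum big_mkcond [RHS]big_mkcond.
apply: eq_bigr => p _; rewrite inE; have [pF|_] := boolP (adj F p.1 p.2).
  by rewrite (subsetP sFE _ pF : adj E _ _).
by case: ifP.
Qed.

Lemma adj_boundary (S : {set V}) x y :
  adj (boundary G S) x y = adj E x y && ((x \in S) (+) (y \in S)).
Proof.
rewrite {1}/adj inE -/(adj E x y); congr (_ && _).
apply/exists_inP/idP => [[a aS /exists_inP[b]]|].
  by rewrite inE => bS /eqP/set2_eq[] [-> ->]; rewrite aS (negPf bS).
have [xS /= yS|xNS /= yS] := boolP (x \in S).
  by exists x => //; apply/exists_inP; exists y; rewrite ?inE ?eqxx.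
by exists y => //; apply/exists_inP; exists x; rewrite ?inE 1?setUC ?eqxx.
Qed.

Lemma adj_induced (S : {set V}) x y :
  adj (induced_edges G S) x y = [&& adj E x y, x \in S & y \in S].
Proof. by rewrite /adj inE subUset !sub1set. Qed.

End EdgeCounting.

(** * Upper bound by signed indicators *)

Section UpperBound.
Variables (R : realType) (V : finType) (G : signed_graph V).
Local Notation E := (edges G).
Local Notation s x y := ((sgn G [set x; y])%:~R : R).

Lemma boundary_sub (S : {set V}) : boundary G S \subset E.
Proof. by apply/subsetP => e; rewrite inE => /andP[]. Qed.

Lemma induced_edges_sub (S : {set V}) : induced_edges G S \subset E.
Proof. by apply/subsetP => e; rewrite inE => /andP[]. Qed.

(** Switch the graph induced on [S] after an optimal removal. A boundary arc then contributes 1 to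
    the energy, a removed arc at most 4, and any other arc 0. *)
Lemma emc_test_function (S : {set V}) : exists f : {ffun V -> R^o},
  \sum_x f x ^+ 2 = #|S|%:R /\
  \sum_x f x * twisted_laplacian_fun G f x
    <= (#|boundary G S| + 4 * emc G S)%:R.
Proof.
have [[F /andP[sF /asboolP cF] <-] _] := emcP G S.
have sFE := subset_trans sF (induced_edges_sub S).
have [theta thetaP] := coherently_signed_switching
  (subset_trans (subsetDl _ F) (induced_edges_sub S)) cF.
exists [ffun x => (-1) ^+ theta x * (x \in S)%:R]; split.
  rewrite -sum1_card natr_sum [RHS]big_mkcond; apply: eq_bigr => x _.
  by rewrite ffunE exprMn sqrr_sign mul1r; case: (x \in S); rewrite ?expr1n ?expr0n.
rewrite -(ler_pM2l (ltr0Sn R 1)) twisted_quadratic_form.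
have -> : 2 * (#|boundary G S| + 4 * #|F|)%:R
    = (2 * #|boundary G S|)%:R + 4 * (2 * #|F|)%:R :> R.
  by rewrite !(natrD, natrM); ring.
rewrite -(sum_arcs_adj R (boundary_sub S)) -(sum_arcs_adj R sFE).
rewrite mulr_sumr -big_split; apply: ler_sum => -[x y] /= xy.
rewrite !ffunE adj_boundary xy /=.
have [F1|FN] := boolP (adj F x y).
  have := subsetP sF _ F1; rewrite -/(adj _ x y) adj_induced => /and3P[_ xS yS].
  rewrite xS yS /= add0r !mulr1.
  have [->|->] := sgn_edge xy; case: (theta x); case: (theta y);
    rewrite ?rmorphN ?expr0 ?expr1; lra.
rewrite mulr0 addr0; have [xS|xS] := boolP (x \in S);
  have [yS|yS] := boolP (y \in S) => /=.
- rewrite (thetaP x y); last first.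
    by rewrite /adj in_setD FN -/(adj _ x y) adj_induced xy xS yS.
  by rewrite rmorph_sign signr_addb !mulr1 -mulrA -expr2
    sqrr_sign mulr1 subrr expr0n.
- by rewrite !mulr0 subr0 mulr1 sqrr_sign.
- by rewrite !mulr1 mulr0 sub0r sqrrN exprMn sgn_sqr // sqrr_sign mulr1.
- by rewrite !mulr0 subr0 expr0n.
Qed.

Lemma smallest_eigenvalue_le_tpsi mu :
  smallest_eigenvalue G mu -> mu <= tpsi R G.
Proof.
move=> muP; have [[S S0 <-] _] := tpsiP R G.
have [f [f2 fle]] := emc_test_function S.
rewrite ler_pdivlMr ?ltr0n ?card_gt0 // -f2.
exact: le_trans (smallest_eigenvalue_rayleigh f muP) fle.
Qed.

Lemma tpsi_le_2psi : tpsi R G <= 2 * psi R G.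
Proof.
have [[S S0 <-] _] := psiP R G; have [_ /(_ S S0) h] := tpsiP R G.
apply: le_trans h _; rewrite /psi_set /tpsi_set mulrA ler_wpM2r ?invr_ge0 ?ler0n //.
rewrite -natrM ler_nat mulnDr mulnA leq_add2r; exact: leq_pmull.
Qed.

End UpperBound.

(** Cauchy-Schwarz without square roots: compare the double sums termwise, using
    [2 c_i c_j <= p_i q_j + p_j q_i]. *)
Lemma sum_le_prod_sqr (R : realFieldType) (I : finType) (P : pred I)
    (c p q : I -> R) :
  (forall i, P i -> [/\ 0 <= c i, 0 <= p i, 0 <= q i & c i ^+ 2 <= p i * q i]) ->
  (\sum_(i | P i) c i) ^+ 2 <= (\sum_(i | P i) p i) * (\sum_(i | P i) q i).
Proof.
move=> cpq; rewrite expr2 -(ler_pM2l (ltr0Sn R 1)) !big_distrlr /=.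
have -> : 2 * \sum_(i | P i) \sum_(j | P j) p i * q j =
    \sum_(i | P i) \sum_(j | P j) (p i * q j + p j * q i).
  rewrite mulr_natl mulr2n [X in _ + X]exchange_big -big_split.
  by apply: eq_bigr => i _; rewrite -big_split.
rewrite mulr_sumr; apply: ler_sum => i /cpq[c1 p1 q1 h1].
rewrite mulr_sumr; apply: ler_sum => j /cpq[c2 p2 q2 h2].
rewrite -ler_sqr ?nnegrE ?addr_ge0 ?mulr_ge0 //.
have h : (c i * c j) ^+ 2 <= (p i * q j) * (p j * q i).
  rewrite exprMn; apply: le_trans (ler_pM (sqr_ge0 _) (sqr_ge0 _) h1 h2) _.
  by rewrite le_eqVlt; apply/orP; left; apply/eqP; ring.
(* [(a + b)^2 = (a - b)^2 + 4 a b >= 4 d^2]. *)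
have := sqr_ge0 (p i * q j - p j * q i).
by move: h; set a := p i * q j; set b := p j * q i; set d := c i * c j; nra.
Qed.

(** * Lower bound by the coarea argument *)

Section LowerBound.
Variables (R : realType) (V : finType) (G : signed_graph V).
Local Notation E := (edges G).
Local Notation s x y := ((sgn G [set x; y])%:~R : R).

(** The sign of [e] after switching by [theta] is +1; the product over [e] avoids ordering its
    endpoints. *)
Definition balanced (theta : V -> bool) (e : {set V}) : bool :=
  sgn G e == \prod_(x in e) (-1) ^+ theta x.

Lemma balancedE theta x y : adj E x y ->
  balanced theta [set x; y] = (sgn G [set x; y] == (-1) ^+ (theta x (+) theta y)).
Proof.
move=> xy; rewrite /balanced (big_setD1 x) ?set21 //= signr_addb.
by rewrite setU1K ?big_set1 // inE (adj_neq xy).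
Qed.

(** Around a cycle every factor coming from [theta] cancels. *)
Lemma balanced_coherent (F : {set {set V}}) theta :
  F \subset E -> {in F, forall e, balanced theta e} -> coherently_signed G F.
Proof.
move=> sFE bal [|a p] //; rewrite /is_cycle => /and3P[_ up].
rewrite /cycle rcons_path => /andP[ap pa].
have thetaP x y : adj F x y -> sgn G [set x; y] = (-1) ^+ (theta x (+) theta y).
  by move=> xy; apply/eqP; rewrite -balancedE ?bal // (subsetP sFE _ xy : adj E x y).
by rewrite (cycle_sgn_cons G up) (path_sgn _ thetaP ap) thetaP // -signr_addb
  [X in _ (+) X]addbC addbb.
Qed.

Lemma emc_le_unbalanced theta (S : {set V}) :
  (emc G S <= #|[set e in induced_edges G S | ~~ balanced theta e]|)%N.
Proof.
have [_ -> //] := emcP G S; apply/andP; split.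
  by apply/subsetP => e; rewrite inE => /andP[].
apply/asboolP; apply: (balanced_coherent (theta := theta)).
  exact: subset_trans (subsetDl _ _) (induced_edges_sub G S).
by move=> e; rewrite in_setD => /andP[+ eS]; rewrite inE eS /= negbK.
Qed.

(** For [u >= 0] and [f x = (-1) ^+ theta x * u x], this is the l^1 energy, the sum of
    [|f x - sgn(x,y) f y|] over arcs. *)
Definition variation (theta : V -> bool) (u : V -> R) : R :=
  \sum_(p | adj E p.1 p.2)
    if balanced theta [set p.1; p.2] then `|u p.1 - u p.2| else u p.1 + u p.2.

(** For an indicator, boundary arcs contribute 1 and unbalanced arcs inside [S] contribute 2; the
    unbalanced edges inside [S] are at least [emc G S] many. *)
Lemma variation_indicator theta (S : {set V}) : S != set0 ->
  2 * (psi R G * #|S|%:R) <= variation theta (fun x => (x \in S)%:R).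
Proof.
move=> S0; have [_ /(_ S S0)] := psiP R G.
rewrite ler_pdivlMr ?ltr0n ?card_gt0 // => psiS.
pose F := [set e in induced_edges G S | ~~ balanced theta e].
have sFE : F \subset E.
  apply: subset_trans (induced_edges_sub G S).
  by apply/subsetP => e; rewrite inE => /andP[].
apply: (@le_trans _ _ (2 * (#|boundary G S| + 2 * #|F|)%:R)).
  rewrite ler_wpM2l // (le_trans psiS) // ler_nat leq_add2l leq_mul2l /=.
  exact: emc_le_unbalanced.
have -> : 2 * (#|boundary G S| + 2 * #|F|)%:R
    = (2 * #|boundary G S|)%:R + 2 * (2 * #|F|)%:R :> R.
  by rewrite !(natrD, natrM); ring.
rewrite -(sum_arcs_adj R (boundary_sub G S)) -(sum_arcs_adj R sFE).
rewrite mulr_sumr -big_split; apply: ler_sum => -[x y] /= xy.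
rewrite adj_boundary xy /= {1}/adj inE -/(adj _ x y) adj_induced xy /=.
case: (balanced _ _); case: (x \in S); case: (y \in S) => /=;
  rewrite ?subrr ?sub0r ?subr0 ?normrN ?normr1 ?normr0; lra.
Qed.

(* Layer-cake decomposition: peel off the minimal positive value of u on its
   support. *)
Lemma variation_ge theta (u : V -> R) : (forall x, 0 <= u x) ->
  2 * (psi R G * \sum_x u x) <= variation theta u.
Proof.
have [n] := ubnP #|[set x | u x != 0]|.
elim: n u => // n IH u /ltnSE-leSn u0; set S := [set x | u x != 0] in leSn.
have [S0|[x0 x0S]] := set_0Vmem S.
  have uE x : u x = 0.
    by apply/eqP; move/setP/(_ x): S0; rewrite !inE => /negbFE.
  rewrite big1 // !mulr0; apply: sumr_ge0 => p _; case: ifP => _ //.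
  by rewrite !uE addr0.
have [xm xmS mle] : exists2 xm, xm \in S & forall x, x \in S -> u xm <= u x.
  by case: (arg_minP u x0S) => xm ? ?; exists xm.
pose m := u xm; pose i x : R := (x \in S)%:R.
have m0 : 0 < m by move: xmS; rewrite lt_def u0 andbT inE.
pose u' x := u x - m * i x.
have u'0 x : 0 <= u' x.
  rewrite /u' /i; have [xS|xS] := boolP (x \in S).
    by rewrite mulr1 subr_ge0 mle.
  by rewrite mulr0 subr0.
have uS x : x \notin S -> u x = 0 by rewrite inE negbK => /eqP.
have lt_S' : (#|[set x | u' x != 0%R]| < n)%N.
  apply: leq_trans leSn; apply: proper_card; apply/properP; split.
    apply/subsetP => x; rewrite inE; apply: contraNT => /[dup] xS /uS.
    by rewrite /u' /i (negPf xS) mulr0 subr0 => ->.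
  by exists xm => //; rewrite inE /u' /i xmS mulr1 subrr eqxx.
have -> : \sum_x u x = \sum_x u' x + m * #|S|%:R.
  rewrite -sum1_card natr_sum [in X in _ + X]big_mkcond mulr_sumr -big_split.
  by apply: eq_bigr => x _; rewrite /u' /i; case: (x \in S) => /=; lra.
(* Additivity: unbalanced terms are linear; inside [S] differences do not change; on an edge leaving
   [S], [u] is 0 outside and at least [m] inside. *)
have -> : variation theta u = variation theta u' + m * variation theta i.
  rewrite mulr_sumr -big_split; apply: eq_bigr => -[x y] _ /=.
  case: (balanced _ _); last by rewrite /u'; lra.
  have := u'0 x; have := u'0 y; rewrite /u' /i.
  have [xS|/uS->] := boolP (x \in S); have [yS|/uS->] := boolP (y \in S);
    rewrite ?mulr1 ?mulr0 ?subr0 ?sub0r ?subrr ?normr0 ?normrN ?normr1 => h1 h2.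
  - by rewrite mulr0 addr0; congr `|_|; lra.
  - by rewrite !ger0_norm // ?u0 //; lra.
  - by rewrite !ger0_norm // ?u0 //; lra.
  - by lra.
have S0 : S != set0 by apply/set0Pn; exists x0.
have h1 := IH u' lt_S' u'0.
have := ler_wpM2l (ltW m0) (variation_indicator theta S0).
by rewrite -/i; move: h1; lra.
Qed.

Lemma deg_le_max x : (deg G x <= max_deg G)%N.
Proof. exact: (leq_bigmax x). Qed.

Lemma psi_ge0 : 0 <= psi R G.
Proof. by rewrite divr_ge0. Qed.

(** The witness [p] is the Rayleigh quotient of [f] with its energy lowered on unbalanced arcs. *)
Lemma eigenvalue_psi_bound mu (f : {ffun V -> R^o}) :
  twisted_laplacian_fun G f = mu *: f -> f != 0 ->
  exists2 p : R, p <= mu & psi R G ^+ 2 <= p * (2 * (max_deg G)%:R - p).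
Proof.
move=> fE f0; pose theta x := f x < 0; pose u x := `|f x|.
pose b (p : V * V) := balanced theta [set p.1; p.2].
pose N := \sum_x u x ^+ 2; pose D : R := (max_deg G)%:R.
have N0 : 0 < N.
  have [x fx] : exists x, f x != 0.
    apply/existsP; apply: contraNT f0; rewrite negb_exists => /forallP h.
    by apply/eqP/ffunP => x; rewrite ffunE; apply/eqP; have := h x; rewrite negbK.
  rewrite /N (bigD1 x) //= ltr_wpDr ?exprn_gt0 ?normr_gt0 // sumr_ge0 // => y _.
  exact: sqr_ge0.
have QE : \sum_(p | adj E p.1 p.2) (f p.1 - s p.1 p.2 * f p.2) ^+ 2 = 2 * (mu * N).
  rewrite -twisted_quadratic_form fE; congr (_ * _); rewrite mulr_sumr.
  apply: eq_bigr => x _; rewrite ffunE /u real_normK ?num_real //.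
  by rewrite mulrCA expr2.
pose P := \sum_(p | adj E p.1 p.2)
  (if b p then (u p.1 - u p.2) ^+ 2 else u p.1 ^+ 2 + u p.2 ^+ 2).
(* [Q] complements [P]: on every arc the two terms add up to [2 u(x)^2 + 2 u(y)^2], and their
   product is the square of the term in the variation of [u^2]. *)
pose Q := \sum_(p | adj E p.1 p.2)
  (if b p then (u p.1 + u p.2) ^+ 2 else u p.1 ^+ 2 + u p.2 ^+ 2).
have u0 x : 0 <= u x by exact: normr_ge0.
have PQ : P + Q <= 4 * D * N.
  have -> : P + Q = 4 * \sum_x (deg G x)%:R * u x ^+ 2.
    rewrite -sum_arcs_deg -big_split /=.
    transitivity (\sum_(p | adj E p.1 p.2) (2 * u p.1 ^+ 2 + 2 * u p.2 ^+ 2)).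
      by apply: eq_bigr => p _; case: ifP => _; ring.
    rewrite big_split -!mulr_sumr /= (sum_arcsC G (fun x _ => u x ^+ 2)) /=.
    by lra.
  rewrite -mulrA ler_pM2l // mulr_sumr; apply: ler_sum => x _.
  by rewrite ler_wpM2r ?sqr_ge0 // ler_nat deg_le_max.
have Pmu : P <= 2 * (mu * N).
  (* On a balanced arc the terms agree; on an unbalanced one the energy is [(u x + u y)^2]. *)
  rewrite -QE; apply: ler_sum => -[x y] /= xy.
  have fu z : f z = (-1) ^+ theta z * u z by rewrite [LHS]realEsign ?num_real.
  rewrite !fu /b /= balancedE //.
  have := u0 x; have := u0 y; case: (sgn_edge xy) => ->;
    case: (theta x); case: (theta y);
    rewrite /= ?expr0 ?expr1 ?rmorphN1 ?eqxx /=; nra.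
have VPQ : variation theta (fun x => u x ^+ 2) ^+ 2 <= P * Q.
  apply: sum_le_prod_sqr => -[x y] /= _; rewrite /b; case: (balanced _ _).
    by rewrite normr_ge0 !sqr_ge0 real_normK ?num_real // subr_sqr exprMn.
  by rewrite !addr_ge0 ?sqr_ge0.
have := variation_ge theta (fun x => sqr_ge0 (u x)); rewrite -/N => psiV.
(* Dividing [(2 psi N)^2 <= P (4 D N - P)] by [(2 N)^2] gives the claim for this [p]. *)
exists (P / (2 * N)); first by rewrite ler_pdivrMr ?mulr_gt0 //; lra.
have P0 : 0 <= P.
  by apply: sumr_ge0 => p _; case: ifP; rewrite ?addr_ge0 ?sqr_ge0.
have psiN : (2 * (psi R G * N)) ^+ 2 <= P * (4 * D * N - P).
  have psiN0 : 0 <= 2 * (psi R G * N).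
    by rewrite mulr_ge0 // mulr_ge0 ?psi_ge0 // ltW.
  apply: (@le_trans _ _ (variation theta (fun x => u x ^+ 2) ^+ 2)).
    by rewrite ler_sqr ?nnegrE // (le_trans psiN0).
  by apply: le_trans VPQ _; rewrite ler_wpM2l // lerBrDl.
have N20 : 0 < (2 * N) ^+ 2 by rewrite exprn_gt0 // mulr_gt0.
rewrite -(ler_pM2r N20); move: psiN; congr (_ <= _); first by ring.
by rewrite -/D; field; rewrite gt_eqF.
Qed.

End LowerBound.

Theorem theorem1p2 (R : realType) (V : finType) (G : signed_graph V)
    (mu1 : R) :
  edges G != set0 ->
  smallest_eigenvalue G mu1 ->
  [/\ psi R G ^+ 2 / (2 * (max_deg G)%:R)
        <= (max_deg G)%:R - Num.sqrt ((max_deg G)%:R ^+ 2 - psi R G ^+ 2),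
      (max_deg G)%:R - Num.sqrt ((max_deg G)%:R ^+ 2 - psi R G ^+ 2) <= mu1,
      mu1 <= tpsi R G
    & tpsi R G <= 2 * psi R G].
Proof.
move=> /set0Pn[e eE] muP; set D : R := (max_deg G)%:R.
have D0 : 0 < D.
  have /cards2P[a [b [_ eab]]] : #|e| == 2%N by rewrite (edges_card2 eE).
  rewrite ltr0n (leq_trans _ (deg_le_max G a)) // card_gt0; apply/set0Pn.
  by exists b; rewrite inE /adj -eab.
have /leigenvalue_twistedP[f fE f0] := muP.1.
have [p pmu psip] := eigenvalue_psi_bound fE f0; rewrite -/D in psip.
set r := Num.sqrt _.
(* Completing the square in [psip]; this also makes the radicand nonnegative. *)
have Dp : (D - p) ^+ 2 <= D ^+ 2 - psi R G ^+ 2 by lra.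
have r2 : r ^+ 2 = D ^+ 2 - psi R G ^+ 2.
  by rewrite sqr_sqrtr // (le_trans (sqr_ge0 _) Dp).
have r0 : 0 <= r by exact: sqrtr_ge0.
have rD : r <= D.
  by rewrite -ler_sqr ?nnegrE ?(ltW D0) // r2 lerBlDr lerDl sqr_ge0.
split; last exact: tpsi_le_2psi.
(* [psi^2 = (D - r)(D + r) <= 2 D (D - r)] since [r <= D]. *)
- by rewrite ler_pdivrMr ?mulr_gt0 //; nra.
- apply: le_trans pmu; suff : D - p <= r by lra.
  rewrite -[r]ger0_norm // (le_trans (ler_norm _)) //.
  by rewrite -ler_sqr ?nnegrE ?normr_ge0 // !real_normK ?num_real // r2.
- exact: smallest_eigenvalue_le_tpsi.
Qed.
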